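(* Take any $p\in(1,2]$ and any measure $\mu$ on any measurable space. Then the space $L^p(\mu)$ is completely $(p,D)$-smooth with the best possible constant $D=\tilde C_p^{1/p}$. So, for any integer $n\ge2$ and any v-martingale $(S_j)_{j=1}^n$ with values in $L^p(\mu)$, with differences $X_1,\dots,X_n$, $$\mathsf E\|S_n\|_p^p\le\mathsf E\|X_1\|_p^p+\tilde C_p\sum_{j=2}^n\mathsf E\|X_j\|_p^p.$$
   Context: A normed space $(\mathfrak X,\|\cdot\|)$ is called completely $(p,D)$-smooth, for $D\in(0,\infty)$, if $$\mathsf E\|x+Xy\|^p\le\|x\|^p+D^p\,\mathsf E|X|^p\,\|y\|^p$$ for all zero-mean real-valued random variables $X$ and all $x,y\in\mathfrak X$. For $p\in(1,2]$, $$\tilde C_p:=\sup_{0<x<s<\infty}\frac{f(x-s)-f(x)+sf'(x)}{f(s)}\quad\text{with } f(u)=|u|^p.$$ $\|\cdot\|_p$ is the norm of $L^p(\mu)$. A sequence $(S_j)_{j=1}^n$ of random vectors in a normed space $(\mathfrak X,\|\cdot\|)$, with differences $X_j:=S_j-S_{j-1}$, $S_0:=0$, is a v-martingale if $\mathsf E\|X_j\|<\infty$ and $\mathsf E(X_j\mid S_{j-1})=0$ for all $j=2,\dots,n$; no condition is imposed on $X_1$. Expectations of nonnegative random variables may equal $+\infty$. *)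

(* Defs.v *)
From HB Require Import structures.
From mathcomp Require Import all_boot all_order all_algebra.
From mathcomp Require Import all_classical all_reals all_analysis.
From mathcomp Require Import measurable_realfun ess_sup_inf.

Set Implicit Arguments.
Unset Strict Implicit.
Unset Printing Implicit Defensive.
Import Order.TTheory GRing.Theory Num.Theory.
Import numFieldNormedType.Exports.

Local Open Scope classical_set_scope.
Local Open Scope ring_scope.

(* [LspaceType mu p1] is the type of a.e.-classes; the library puts no algebraic
   structure on it. It is made a normed module here, operating on representatives
   and with norm [fine 'N[mu]_p[_]]. *)
Section Lspace_normed.
Context d (T : measurableType d) (R : realType).
Variables (mu : {measure set T -> \bar R}) (p : \bar R) (p1 : (1 <= p)%E).
Local Open Scope quotient_scope.

Local Notation L := (LspaceType mu p1).
Local Notation Lf := (LfunType mu p1).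
Local Notation Q := ({mfun_ mu, T >-> measurableTypeR R}).

Lemma ae_eq_Lnorm (f g : T -> R) : f = g %[ae mu] ->
  measurable_fun setT f -> measurable_fun setT g ->
  'N[mu]_p[EFin \o f]%E = 'N[mu]_p[EFin \o g]%E.
Proof.
move=> fg mf mg.
have mN (h : T -> R) r : measurable_fun setT h ->
    measurable_fun setT (fun x => `|(h x)%:E| `^ r)%E.
  move=> mh; apply: (measurableT_comp (measurable_poweR _)) => //.
  by apply: measurableT_comp => //; exact/measurable_EFinP.
rewrite unlock; case: p => [r| |].
- congr (_ `^ _)%E; apply: ae_eq_integral => //; [exact: mN|exact: mN|].
  by apply: filterS fg => x fgx _ /=; rewrite (fgx I).
- case: ifPn => // _; apply: eq_ess_sup.
  by apply: filterS fg => x fgx /=; rewrite (fgx I).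
- case: ifPn => // _; apply: eq_ess_inf.
  by apply: filterS fg => x fgx /=; rewrite (fgx I).
Qed.

Lemma Lspace_measurable (x : L) : measurable_fun setT (x : T -> measurableTypeR R).
Proof. exact: (@measurable_funPT _ _ _ _ (repr (x : Q))). Qed.

Lemma Lspace_in_Lfun (x : L) : (x : T -> R) \in Lfun mu p.
Proof.
apply/andP; split; rewrite inE/=; first exact: Lspace_measurable.
exact: Lebesgue_finite.
Qed.

Definition Lspace_repr (x : L) : Lf := Lfun_Sub p1 (Lspace_in_Lfun x).

Lemma Lfun_in_mfun (f : Lf) :
  (f : T -> measurableTypeR R) \in (@mfun _ _ T (measurableTypeR R)).
Proof. by rewrite inE; exact: (@measurable_funPT _ _ _ _ f). Qed.

Definition Lfun_pi (f : Lf) : Q := \pi_Q (mfun_Sub (Lfun_in_mfun f)).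

Lemma Lfun_pi_ae (f : Lf) : (Lfun_pi f : T -> R) = f %[ae mu].
Proof.
have := reprK (Lfun_pi f); rewrite {2}/Lfun_pi => /eqP.
by rewrite eqmodE => /asboolP.
Qed.

Lemma Lfun_pi_finite (f : Lf) : finite_norm mu p (Lfun_pi f : T -> R).
Proof.
have mpi : measurable_fun setT (Lfun_pi f : T -> R).
  exact: (@measurable_funPT _ _ _ _ (repr (Lfun_pi f))).
have mf : measurable_fun setT (f : T -> R) by exact: measurable_funPT.
rewrite /finite_norm (ae_eq_Lnorm (Lfun_pi_ae f) mpi mf).
exact: Lfunction_finite.
Qed.

Definition Lspace_class (f : Lf) : L :=
  @LebesgueSpace.Pack d T R mu p p1 (Lfun_pi f)
    (LebesgueSpace.Class (@isFinLebesgue.Build d T R mu p p1 (Lfun_pi f) (Lfun_pi_finite f))).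

Lemma Lspace_class_ae (f : Lf) : (Lspace_class f : T -> R) = f %[ae mu].
Proof. exact: Lfun_pi_ae. Qed.

Lemma Lspace_aeP (x y : L) : (x : T -> R) = y %[ae mu] -> x = y.
Proof.
move=> xy; have : (x : Q) = y by rewrite -[LHS]reprK -[RHS]reprK; apply/eqP; rewrite eqmodE; apply/asboolP.
case: x {xy} => x [[fx]]; case: y => y [[fy]] /= xy.
by subst y; rewrite (Prop_irrelevance fx fy).
Qed.

Lemma Lspace_class_eq (f g : Lf) : (f : T -> R) = g %[ae mu] ->
  Lspace_class f = Lspace_class g.
Proof.
move=> fg; apply: Lspace_aeP.
by apply: filterS3 (Lspace_class_ae f) (Lspace_class_ae g) fg => t /= -> // -> // ->.
Qed.

Lemma Lspace_reprK : cancel Lspace_repr Lspace_class.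
Proof. by move=> x; apply: Lspace_aeP; exact: Lspace_class_ae. Qed.

HB.instance Definition _ := gen_eqMixin L.
HB.instance Definition _ := gen_choiceMixin L.

Let addL (x y : L) : L := Lspace_class (Lspace_repr x + Lspace_repr y).
Let oppL (x : L) : L := Lspace_class (- Lspace_repr x).
Let scaleL (a : R) (x : L) : L := Lspace_class (a *: Lspace_repr x).
Let zeroL : L := Lspace_class 0.
Let normL (x : L) : R := fine ('N[mu]_p[EFin \o (x : T -> R)])%E.

Let class_add f g : addL (Lspace_class f) (Lspace_class g) = Lspace_class (f + g).
Proof.
apply: Lspace_class_eq.
by apply: filterS2 (Lspace_class_ae f) (Lspace_class_ae g) => t /= fE gE _; rewrite !fctE/= fE// gE.
Qed.

Let class_opp f : oppL (Lspace_class f) = Lspace_class (- f).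
Proof.
apply: Lspace_class_eq.
by apply: filterS (Lspace_class_ae f) => t /= fE _; rewrite !fctE/= fE.
Qed.

Let class_scale a f : scaleL a (Lspace_class f) = Lspace_class (a *: f).
Proof.
apply: Lspace_class_eq.
by apply: filterS (Lspace_class_ae f) => t /= fE _; rewrite !fctE/= fE.
Qed.

Let addLA : associative addL.
Proof.
move=> x y z; rewrite -(Lspace_reprK x) -(Lspace_reprK y) -(Lspace_reprK z).
by rewrite !class_add addrA.
Qed.

Let addLC : commutative addL.
Proof. by move=> x y; rewrite /addL addrC. Qed.

Let add0L : left_id zeroL addL.
Proof. by move=> x; rewrite -(Lspace_reprK x) class_add add0r. Qed.

Let addNL : left_inverse zeroL oppL addL.
Proof. by move=> x; rewrite -(Lspace_reprK x) class_opp class_add addNr. Qed.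

HB.instance Definition _ := GRing.isZmodule.Build L addLA addLC add0L addNL.

Let scaleLA a b (x : L) : scaleL a (scaleL b x) = scaleL (a * b) x.
Proof. by rewrite -(Lspace_reprK x) !class_scale scalerA. Qed.

Let scale1L : left_id 1 scaleL.
Proof. by move=> x; rewrite -(Lspace_reprK x) class_scale scale1r. Qed.

Let scaleLDr : right_distributive scaleL +%R.
Proof.
move=> a x y; rewrite -(Lspace_reprK x) -(Lspace_reprK y).
change (scaleL a (addL (Lspace_class (Lspace_repr x)) (Lspace_class (Lspace_repr y))) =
  addL (scaleL a (Lspace_class (Lspace_repr x))) (scaleL a (Lspace_class (Lspace_repr y)))).
by rewrite class_add !class_scale class_add scalerDr.
Qed.

Let scaleLDl (x : L) : {morph scaleL^~ x : a b / a + b}.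
Proof.
move=> a b; rewrite -(Lspace_reprK x).
set f := Lspace_repr x.
change (scaleL (a + b) (Lspace_class f) =
  addL (scaleL a (Lspace_class f)) (scaleL b (Lspace_class f))).
by rewrite !class_scale class_add scalerDl.
Qed.

HB.instance Definition _ :=
  GRing.Zmodule_isLmodule.Build R L scaleLA scale1L scaleLDr scaleLDl.

Lemma LspaceD_ae (x y : L) : ((x + y)%R : T -> R) = (x : T -> R) \+ y %[ae mu].
Proof. exact: Lspace_class_ae. Qed.

Lemma LspaceZ_ae (a : R) (x : L) :
  ((a *: x)%R : T -> R) = (fun t => a * (x : T -> R) t) %[ae mu].
Proof. exact: Lspace_class_ae. Qed.

Lemma Lspace0_ae : ((0 : L) : T -> R) = cst 0 %[ae mu].
Proof. exact: Lspace_class_ae. Qed.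

Let normL_class f : normL (Lspace_class f) = fine ('N[mu]_p[EFin \o (f : T -> R)])%E.
Proof.
congr fine; apply: ae_eq_Lnorm.
- exact: Lspace_class_ae.
- exact: Lspace_measurable.
- exact: measurable_funPT.
Qed.

Let ler_normLD (x y : L) : normL (x + y) <= normL x + normL y.
Proof.
rewrite -(Lspace_reprK x) -(Lspace_reprK y).
set f := Lspace_repr x; set g := Lspace_repr y.
change (normL (addL (Lspace_class f) (Lspace_class g)) <=
  normL (Lspace_class f) + normL (Lspace_class g)).
by rewrite class_add !normL_class; exact: ler_LnormD.
Qed.

Let normLZ a (x : L) : normL (a *: x) = `|a| * normL x.
Proof.
rewrite -(Lspace_reprK x); set f := Lspace_repr x.
change (normL (scaleL a (Lspace_class f)) = `|a| * normL (Lspace_class f)).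
rewrite class_scale !normL_class.
apply: EFin_inj; rewrite EFinM !finite_norm_fine; exact: LnormZ.
Qed.

Let normL0_eq0 (x : L) : normL x = 0 -> x = 0.
Proof.
move=> x0; apply: Lspace_aeP.
have h : (x : T -> R) = cst 0 %[ae mu].
  by apply: (@fine_Lnormr_eq0 _ _ _ _ _ p1 (Lspace_repr x)).
by apply: filterS2 h Lspace0_ae => t /= -> // -> .
Qed.

HB.instance Definition _ :=
  Lmodule_isNormed.Build R L ler_normLD normLZ normL0_eq0.

Lemma Lspace_normE (x : L) : `|x| = fine ('N[mu]_p[EFin \o (x : T -> R)])%E.
Proof. by []. Qed.

End Lspace_normed.

Lemma lt1_lee1 (R : realType) (p : R) : 1 < p -> (1 <= p%:E)%E.
Proof. by move=> p1; rewrite lee_fin ltW. Qed.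

(* [sup] is [0] on unbounded sets; the positivity of [D] required in
   [completely_smooth] below rules this degenerate case out. *)
Definition Ctilde (R : realType) (p : R) : R :=
  let f := fun u : R => `|u| `^ p in
  sup [set r | exists x s : R, [/\ 0 < x, x < s &
                r = (f (x - s) - f x + s * derive1 f x) / f s]].

Definition completely_smooth (R : realType) (p D : R) (V : normedModType R) :=
  0 < D /\
  forall (d : measure_display) (Omega : measurableType d)
      (P : probability Omega R) (X : {RV P >-> R}),
    P.-integrable setT (EFin \o X) -> ('E_P[X] = 0)%E ->
    forall x y : V,
      ('E_P[fun w => (`|x + X w *: y| `^ p)%R] <=
       (`|x| `^ p)%:E +
         (D `^ p)%:E * 'E_P[fun w => (`|X w| `^ p)%R] * (`|y| `^ p)%:E)%E.

Section random_vectors.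
Context d (Omega : measurableType d) (R : realType) (V : normedModType R).
Implicit Types (X Y : Omega -> V) (G : set_system Omega).

Definition borel : set_system V := <<s [set U : set V | open U] >>.

(* strong measurability: Borel measurability with separable range *)
Definition strongly_measurable G X :=
  (forall B, borel B -> G (X @^-1` B)) /\
  exists2 D : set V, countable D & range X `<=` closure D.

Definition random_vector X := strongly_measurable measurable X.

Definition simple_vector X :=
  finite_set (range X) /\ forall v : V, measurable (X @^-1` [set v]).

Definition simple_expectation (P : probability Omega R) X : V :=
  \sum_(v \in range X) fine (P (X @^-1` [set v])) *: v.

(* [X] is Bochner integrable with Bochner expectation [v] *)
Definition has_expectation (P : probability Omega R) X (v : V) :=
  random_vector X /\
  exists Xn : nat -> Omega -> V,
    [/\ forall n, simple_vector (Xn n),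
        ('E_P[fun w => `|Xn n w - X w|%R] @[n --> \oo] --> 0)%E &
        simple_expectation P (Xn n) @[n --> \oo] --> v].

Definition restrict_event (A : set Omega) X : Omega -> V :=
  fun w => (\1_A w : R) *: X w.

(* [Y] is a version of [E(X | G)], for a sub-sigma-algebra [G] *)
Definition is_cond_expectation (P : probability Omega R) X G Y :=
  strongly_measurable G Y /\
  forall A, G A -> exists v : V,
    has_expectation P (restrict_event A X) v /\
    has_expectation P (restrict_event A Y) v.

Definition sigma_rv X : set_system Omega := preimage_set_system setT X borel.

(* only [S 1], ..., [S n] matter: whatever [S 0] is, it is replaced by 0 *)
Definition mdiff (S : nat -> Omega -> V) (j : nat) : Omega -> V :=
  fun w => S j w - (if j.-1 == 0%N then 0 else S j.-1 w).

Definition v_martingale (P : probability Omega R) (n : nat)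
    (S : nat -> Omega -> V) :=
  (forall j, (1 <= j <= n)%N -> random_vector (S j)) /\
  (forall j, (2 <= j <= n)%N ->
    ('E_P[fun w => `|mdiff S j w|%R] < +oo)%E /\
    is_cond_expectation P (mdiff S j) (sigma_rv (S j.-1)) (cst 0)).

End random_vectors.

(* Main.v *)
Require Import Defs.
From HB Require Import structures.
From mathcomp Require Import all_boot all_order all_algebra.
From mathcomp Require Import all_classical all_reals all_analysis.
From mathcomp Require Import measurable_realfun ess_sup_inf.
From mathcomp Require Import ring lra.

(** Everything rests on one scalar inequality, [norm_powR_smooth]: for all real
    [a] and [b],
      [`|a + b| `^ p <= `|a| `^ p + dpow p a * b + Ctilde p * `|b| `^ p],
    where [dpow p] is the derivative of [fun u => `|u| `^ p]. When the increment
    [b] carries [a] across [0] this is the definition of [Ctilde p]; otherwise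
    it holds with the constant [1 <= Ctilde p], because the power [p - 1] is
    concave and subadditive.

    Integrating it over the measure space gives the same inequality for the
    norm of the function space ([Lspace_smooth]), with [dpow p a * b] replaced
    by a functional [dnorm_powR x] that is linear and bounded by Hoelder's
    inequality. For fixed [x] and [y] and a centred real variable [X], putting
    the increment [X w *: y] and taking expectations kills the linear term: this
    is complete smoothness. The integral over [w] is taken outside the
    inequality for the norm, so the two integrals are never exchanged and [mu]
    may be any measure.

    For a martingale the linear term is [dnorm_powR (S w) (X w)], where the
    functional is itself random. Since [dpow p] is Hoelder continuous of
    exponent [p - 1], [dnorm_powR x] depends on [x] uniformly continuously
    ([dnorm_powR_holder]), so the functional may be frozen on each of countably
    many events on which [S] is nearly constant; a frozen functional commutes
    with Bochner expectations ([expectation_functional]) and averages to zero by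
    the martingale condition. This is [smooth_centered_step], and induction
    along the differences gives [v_martingale_smooth].

    Optimality is seen on a line: testing smoothness with a variable taking the
    values [- s] and [t], and letting [t] tend to [0], recovers the quotient
    whose supremum is [Ctilde p] ([completely_smooth_lower]). *)

Set Implicit Arguments.
Unset Strict Implicit.
Unset Printing Implicit Defensive.
Import Order.TTheory GRing.Theory Num.Theory.
Import numFieldNormedType.Exports.

Local Open Scope classical_set_scope.
Local Open Scope ring_scope.

(** * The power function on the real line *)

Section real_line.
Context {R : realType}.
Implicit Types x y a b s t u p q : R.

(** Average the tangent bound [1 + z <= expR z] at [z = (1 - q) * ln t] and at
    [z = - q * ln t] with weights [q] and [1 - q]: the logarithms cancel. *)
Lemma powR_bernoulli q t : 0 <= q <= 1 -> 0 <= t -> t `^ q <= 1 + q * (t - 1).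
Proof.
move=> /andP[q0 q1]; rewrite le_eqVlt => /predU1P[<-|t0].
  have [->|qn0] := eqVneq q 0; first by rewrite powRr0; lra.
  by rewrite powR0//; lra.
have tqE : t `^ q = expR (q * ln t) by rewrite /powR gt_eqF.
have tE : t = expR (ln t) by rewrite lnK.
move: (ln t) tE tqE => L tE tqE.
have e0 := expR_gt0 (q * L).
have h1 : expR (q * L) * (1 + (1 - q) * L) <= t.
  have -> : t = expR (q * L) * expR ((1 - q) * L).
    by rewrite -expRD -mulrDl addrCA subrr addr0 mul1r.
  by rewrite ler_pM2l//; exact: expR_ge1Dx.
have h2 : expR (q * L) * (1 + - (q * L)) <= 1.
  rewrite [leRHS](_ : _ = expR (q * L) * expR (- (q * L))); last first.
    by rewrite -expRD subrr expR0.
  by rewrite ler_pM2l//; exact: expR_ge1Dx.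
rewrite tqE.
have g1 : q * (expR (q * L) * (1 + (1 - q) * L)) <= q * t.
  by apply: ler_wpM2l.
have g2 : (1 - q) * (expR (q * L) * (1 + - (q * L))) <= (1 - q) * 1.
  by apply: ler_wpM2l => //; lra.
nra.
Qed.

(** The graph of [fun z => z `^ q] lies below its tangent at [x]; multiplying
    by [x] keeps the negative exponent [q - 1] out of the formula. *)
Lemma powR_tangent_le q x u : 0 <= q <= 1 -> 0 < x -> 0 <= x + u ->
  x * (x + u) `^ q <= x * x `^ q + q * u * x `^ q.
Proof.
move=> q01 x0 xu0.
have -> : x + u = x * (1 + u / x) by rewrite mulrDr mulr1 mulrC divfK ?gt_eqF.
have h : 0 <= 1 + u / x.
  have -> : 1 + u / x = (x + u) / x by rewrite mulrDl divff ?gt_eqF.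
  by rewrite divr_ge0// ltW.
rewrite powRM ?(ltW x0)//.
have := powR_bernoulli q01 h.
rewrite (addrC 1) addrK => h1.
have : x * x `^ q * (u / x + 1) `^ q <= x * x `^ q * (1 + q * (u / x)).
  by rewrite ler_wpM2l// mulr_ge0// ?powR_ge0// ltW.
rewrite [x * (_ * _)]mulrA => /le_trans; apply.
rewrite le_eqVlt; apply/orP; left; apply/eqP.
by field; rewrite gt_eqF.
Qed.

Lemma powR_subadd q a b : 0 < q <= 1 -> 0 <= a -> 0 <= b ->
  (a + b) `^ q <= a `^ q + b `^ q.
Proof.
move=> /andP[q0 q1]; rewrite le_eqVlt => /predU1P[<- b0|a0].
  by rewrite powR0 ?gt_eqF// !add0r.
rewrite le_eqVlt => /predU1P[<-|b0].
  by rewrite powR0 ?gt_eqF// !addr0.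
have c0 : 0 < a + b by rewrite addr_gt0.
(* The ratio [r = z / (a + b)] lies in (0, 1], where [r <= r `^ q]. *)
have frac z : 0 < z -> z <= a + b -> (a + b) `^ q * (z / (a + b)) <= z `^ q.
  move=> z0 zc.
  have {2}-> : z = (a + b) * (z / (a + b)) by rewrite mulrC divfK ?gt_eqF.
  rewrite powRM ?(ltW c0)//; last by rewrite divr_ge0// ltW.
  rewrite ler_wpM2l ?powR_ge0// ger1_powR// divr_gt0//=.
  by rewrite ler_pdivrMr// mul1r.
have ha := frac a a0 ltac:(lra); have hb := frac b b0 ltac:(lra).
have := lerD ha hb; rewrite -mulrDr -mulrDl divff ?gt_eqF// mulr1; exact.
Qed.

Let powE p x : 1 <= p -> 0 <= x -> x `^ p = x * x `^ (p - 1).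
Proof. by move=> p1 x0; rewrite mulr_powRB1//; lra. Qed.

(** For [1 < p], the derivative of [fun u => `|u| `^ p]. *)
Definition dpow p a := p * Num.sg a * `|a| `^ (p - 1).

Lemma dpowN p a : dpow p (- a) = - dpow p a.
Proof. by rewrite /dpow sgrN normrN mulrN mulNr. Qed.

Lemma dpow_pos p a : 0 < a -> dpow p a = p * a `^ (p - 1).
Proof. by move=> a0; rewrite /dpow gtr0_sg// mulr1 gtr0_norm. Qed.

Lemma derive1_norm_powR p x : 0 < x ->
  derive1 (fun u => `|u| `^ p) x = p * x `^ (p - 1).
Proof.
move=> x0; transitivity (derive1 (fun u : R => u `^ p) x); last first.
  by rewrite powR_derive1// in_itv/= x0.
rewrite !derive1E; apply: near_eq_derive.
by near=> y; rewrite ger0_norm//; apply: ltW; near: y; exact: lt_nbhsr.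
Unshelve. all: by end_near. Qed.

(** [Ctilde p] is the [sup] of this set; naming it lets its boundedness be
    proved once, and boundedness is what makes [sup] meaningful. *)
Definition Ctilde_set p := [set r : R | exists x s : R, [/\ 0 < x, x < s &
  r = (`|x - s| `^ p - `|x| `^ p + s * derive1 (fun u => `|u| `^ p) x)
      / `|s| `^ p]].

Lemma Ctilde_has_sup p : 1 < p -> has_sup (Ctilde_set p).
Proof.
move=> p1.
split.
  by eexists; exists 1, 2; split; [lra|lra|reflexivity].
exists (1 + p) => _ [x [s [x0 xs ->]]]; have s0 := lt_trans x0 xs.
rewrite derive1_norm_powR// (gtr0_norm x0) (gtr0_norm s0) ler_pdivrMr ?powR_gt0//.
have -> : `|x - s| = s - x by rewrite ltr0_norm; lra.
have h1 : (s - x) `^ p <= s `^ p by rewrite ge0_ler_powR ?nnegrE; lra.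
have h2 : x `^ (p - 1) <= s `^ (p - 1) by rewrite ge0_ler_powR ?nnegrE; lra.
have h3 := powR_ge0 x p.
have : s * (p * x `^ (p - 1)) <= p * (s `^ p).
  by rewrite (powE (ltW p1) (ltW s0)) mulrCA ler_wpM2l ?ler_wpM2l//; lra.
lra.
Qed.

Lemma Ctilde_ubound p x s : 1 < p -> 0 < x -> x < s ->
  (s - x) `^ p - x `^ p + s * (p * x `^ (p - 1)) <= Ctilde p * s `^ p.
Proof.
move=> p1 x0 xs; have s0 := lt_trans x0 xs.
rewrite -ler_pdivrMr ?powR_gt0//; apply: ub_le_sup; first exact: (Ctilde_has_sup p1).2.
exists x, s; split => //; rewrite derive1_norm_powR// (gtr0_norm x0) (gtr0_norm s0).
by have -> : `|x - s| = s - x by rewrite ltr0_norm; lra.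
Qed.

Lemma Ctilde_lubP p B : 1 < p ->
  (forall x s, 0 < x -> x < s ->
    (s - x) `^ p - x `^ p + s * (p * x `^ (p - 1)) <= B * s `^ p) ->
  Ctilde p <= B.
Proof.
move=> p1 hB; apply: ge_sup; first exact: (Ctilde_has_sup p1).1.
move=> _ [x [s [x0 xs ->]]]; have s0 := lt_trans x0 xs.
rewrite derive1_norm_powR// (gtr0_norm x0) (gtr0_norm s0) ler_pdivrMr ?powR_gt0//.
have -> : `|x - s| = s - x by rewrite ltr0_norm; lra.
exact: hB.
Qed.

(** Tangent line below a convex power, obtained from the concave case: apply
    it with exponent [p^-1] at the point [((x + u) / x) `^ p]. *)
Lemma powR_tangent_ge p x u : 1 <= p -> 0 < x -> 0 <= x + u ->
  x `^ p + u * (p * x `^ (p - 1)) <= (x + u) `^ p.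
Proof.
move=> p1 x0 xu0.
have t0 : 0 <= (x + u) / x by rewrite divr_ge0// ltW.
have /powR_bernoulli/(_ (powR_ge0 ((x + u) / x) p)) : 0 <= p^-1 <= 1.
  by rewrite invr_ge0 invf_le1; [apply/andP; split|]; lra.
rewrite -powRrM divff ?powRr1//; last by rewrite gt_eqF//; lra.
move=> h; have {}h : p * ((x + u) / x - 1) <= ((x + u) / x) `^ p - 1.
  by rewrite -ler_pdivlMl; [lra|lra].
have -> : (x + u) `^ p = x `^ p * ((x + u) / x) `^ p.
  rewrite -powRM ?(ltW x0)//; congr (_ `^ _).
  by rewrite [RHS]mulrC divfK ?gt_eqF.
have -> : u * (p * x `^ (p - 1)) = x `^ p * (p * ((x + u) / x - 1)).
  by rewrite (powE p1 (ltW x0)) ; field; rewrite gt_eqF.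
have := ler_wpM2l (powR_ge0 x p) h; lra.
Qed.

(** Small [x] relative to [s]: with [s = 1] the quotient defining [Ctilde p] is
    at least [1 - x]. *)
Lemma Ctilde_ge1 p : 1 < p -> p <= 2 -> 1 <= Ctilde p.
Proof.
move=> p1 p2; apply/ler_addgt0Pl => e e0.
have [x [x0 x1 xe]] : exists x : R, [/\ 0 < x, x < 1 & x <= e].
  have [e1|e1] := ltP e (1 / 2); first by exists e; split=> //; lra.
  by exists (1 / 2); split; lra.
have := Ctilde_ubound p1 x0 x1; rewrite powR1 mulr1 mul1r.
have h1 := @powR_tangent_ge p 1 (- x) (ltW p1) ltr01 ltac:(lra).
rewrite !powR1 in h1.
have h2 : x `^ p <= x by rewrite ge1r_powR ?x0; lra.
have h3 : x <= x `^ (p - 1) by rewrite ger1_powR ?x0; lra.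
have : p * x <= p * x `^ (p - 1) by rewrite ler_pM2l; lra.
lra.
Qed.

(** Once the sign symmetry reduces to [0 <= a], there are three regimes. For
    [0 <= b], and for [b < 0] with [0 <= a + b], writing each [z `^ p] as
    [z * z `^ (p - 1)] and using concavity and subadditivity of the power
    [p - 1] gives the bound with constant [1 <= Ctilde p]. When [a + b < 0] the
    increment crosses the origin, and this is the configuration over which
    [Ctilde p] is a supremum. *)
Lemma norm_powR_smooth p a b : 1 < p -> p <= 2 ->
  `|a + b| `^ p <= `|a| `^ p + dpow p a * b + Ctilde p * `|b| `^ p.
Proof.
move=> p1 p2; have C1 := Ctilde_ge1 p1 p2.
have q01 : 0 < p - 1 <= 1 by apply/andP; split; lra.
have q0 : 0 <= p - 1 <= 1 by apply/andP; split; lra.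
have pn0 : p != 0 by rewrite gt_eqF//; lra.
wlog a0 : a b / 0 <= a => [hw|].
  have [/hw//|a0] := leP 0 a.
  have := hw (- a) (- b) ltac:(lra).
  by rewrite -opprD !normrN dpowN mulrNN.
have bp0 := powR_ge0 `|b| p.
have bC : `|b| `^ p <= Ctilde p * `|b| `^ p by rewrite ler_peMl.
move: a0; rewrite le_eqVlt => /predU1P[<-|a0].
  by rewrite add0r normr0 /dpow sgr0 mulr0 !mul0r addr0 powR0// add0r.
rewrite dpow_pos// (gtr0_norm a0).
have [b0|b0] := leP 0 b.
  have ab0 : 0 <= a + b by lra.
  rewrite (ger0_norm b0) (ger0_norm ab0) in bC bp0 *.
  have h1 := powR_tangent_le q0 a0 ab0.
  have h2 : b * (a + b) `^ (p - 1) <= b * (a `^ (p - 1) + b `^ (p - 1)).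
    by rewrite ler_wpM2l// powR_subadd// ltW.
  have := powE (ltW p1) ab0; have := powE (ltW p1) b0; have := powE (ltW p1) (ltW a0).
  have -> : p = 1 + (p - 1) by lra.
  have -> : 1 + (p - 1) = p by lra.
  have : p * a `^ (p - 1) * b = b * a `^ (p - 1) + (p - 1) * b * a `^ (p - 1) by ring.
  lra.
rewrite (ltr0_norm b0) in bC bp0 *.
have [ab0|ab0] := leP 0 (a + b).
  rewrite (ger0_norm ab0).
  have h1 := powR_tangent_le q0 a0 ab0.
  have h2 : - b * a `^ (p - 1) <= - b * ((a + b) `^ (p - 1) + (- b) `^ (p - 1)).
    rewrite ler_wpM2l//; first lra.
    by have := @powR_subadd (p - 1) (a + b) (- b) q01 ab0 ltac:(lra); rewrite addrK.
  have := powE (ltW p1) ab0; have := @powE p (- b) (ltW p1) ltac:(lra); have := powE (ltW p1) (ltW a0).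
  have : p * a `^ (p - 1) * b = b * a `^ (p - 1) + (p - 1) * b * a `^ (p - 1) by ring.
  lra.
rewrite (ltr0_norm ab0).
have := @Ctilde_ubound p a (- b) p1 a0 ltac:(lra).
have -> : - b - a = - (a + b) by lra.
lra.
Qed.

(** Between points of the same sign this is subadditivity of the power [p - 1];
    points of opposite signs are both closer to [0] than to each other, whence
    the factor [2]. *)
Lemma dpow_holder p a b : 1 < p -> p <= 2 ->
  `|dpow p a - dpow p b| <= 2 * p * `|a - b| `^ (p - 1).
Proof.
move=> p1 p2; have q01 : 0 < p - 1 <= 1 by apply/andP; split; lra.
have q00 : p - 1 != 0 by lra.
have sub x y : 0 <= x -> x <= y -> p * y `^ (p - 1) - p * x `^ (p - 1) <= p * (y - x) `^ (p - 1).
  move=> x0 xy; rewrite -mulrBr ler_pM2l; last lra.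
  have := @powR_subadd (p - 1) x (y - x) q01 x0 ltac:(lra); rewrite subrKC; lra.
have dE x : 0 <= x -> dpow p x = p * x `^ (p - 1).
  rewrite le_eqVlt => /predU1P[<-|/dpow_pos//].
  by rewrite /dpow sgr0 powR0// !mulr0 mul0r.
have le_q x y : 0 <= x -> x <= y -> p * x `^ (p - 1) <= p * y `^ (p - 1).
  by move=> x0 xy; rewrite ler_pM2l ?ge0_ler_powR ?nnegrE//; lra.
wlog ab : a b / b <= a => [hw|].
  have [/hw//|/ltW/hw] := leP b a.
  by rewrite distrC (distrC b).
have d0 := powR_ge0 (a - b) (p - 1).
rewrite (@ger0_norm _ (a - b)) ?subr_ge0//.
wlog a0 : a b ab d0 / 0 <= a => [hw|].
  have [a0|a0] := leP 0 a; first exact: hw.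
  have := hw (- b) (- a) ltac:(lra); rewrite opprK (addrC (- b)) !dpowN opprK.
  by rewrite (addrC (- _)); apply => //; lra.
have [b0|b0] := leP 0 b.
  rewrite !dE// ger0_norm; last by have := le_q b a b0 ab; lra.
  have := sub b a b0 ab.
  have : 0 <= p * (a - b) `^ (p - 1) by rewrite mulr_ge0//; lra.
  lra.
have -> : dpow p b = - dpow p (- b) by rewrite dpowN opprK.
rewrite opprK !dE//; last lra.
have h1 := le_q a (a - b) a0 ltac:(lra).
have h2 := @le_q (- b) (a - b) ltac:(lra) ltac:(lra).
rewrite ger0_norm; first lra.
by rewrite addr_ge0// mulr_ge0 ?powR_ge0//; lra.
Qed.

End real_line.

(** * Smoothness of the norm of the space of p-integrable functions *)

Lemma measurable_dpow (R : realType) (p : R) : measurable_fun setT (dpow p).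
Proof.
(* The indicator of [a == 0] covers [p = 1], where [0 `^ (p - 1) = 1]. *)
have -> : dpow p = (fun a => p * ((if a < 0 then -1 else 1) *
    (if a == 0 then 0 else `|a| `^ (p - 1)))).
  apply/funext => a; rewrite /dpow; case: ltgtP => a0.
  - by rewrite ltr0_sg// mulrA.
  - by rewrite gtr0_sg// mulrA.
  - by rewrite a0 sgr0 mul1r !mulr0 mul0r.
apply: measurable_funM => //; apply: measurable_funM => //.
  by apply: measurable_fun_ifT => //; exact: measurable_fun_ltr.
apply: measurable_fun_ifT => //; first exact: measurable_fun_eqr.
by apply: (measurableT_comp (measurable_powR _)) => //; exact: normr_measurable.
Qed.

Section Lspace_tangent.
Context d (T : measurableType d) (R : realType).
Variables (mu : {measure set T -> \bar R}) (p : R) (p_ge1 : (1 <= p%:E)%E).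
Local Notation L := (LspaceType mu p_ge1).
Implicit Types x y v : L.

Let p1 : 1 <= p. Proof. by rewrite -lee_fin. Qed.

Lemma Lspace_EFin_norm x : `|x|%:E = ('N[mu]_(p%:E)[EFin \o (x : T -> R)])%E.
Proof. by rewrite Lspace_normE; exact: (finite_norm_fine (Lspace_repr x)). Qed.

Lemma Lspace_norm_powR x :
  (`|x| `^ p)%:E = (\int[mu]_t (`|(x : T -> R) t| `^ p)%:E)%E.
Proof.
rewrite -poweR_EFin Lspace_EFin_norm poweR_Lnorm//.
by rewrite gt_eqF// (lt_le_trans _ p1).
Qed.

Lemma Lspace_integrable x :
  mu.-integrable setT (fun t => (`|(x : T -> R) t| `^ p)%:E).
Proof. by apply: (Lfun_integrable p1); exact: Lspace_in_Lfun. Qed.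

(** Hoelder's inequality for the conjugate exponents [p / (p - 1)] and [p]. *)
Lemma Lspace_hoelder x y : 1 < p ->
  (\int[mu]_t (`|(x : T -> R) t| `^ (p - 1) * `|(y : T -> R) t|)%:E <=
   (`|x| `^ (p - 1) * `|y|)%:E)%E.
Proof.
move=> p_gt1; have p0 : 0 < p by lra.
have q0 : 0 < p - 1 by lra.
have mx := @Lspace_measurable _ _ _ _ _ _ x.
have my := @Lspace_measurable _ _ _ _ _ _ y.
pose h t := `|(x : T -> R) t| `^ (p - 1).
have mh : measurable_fun setT h.
  by apply: (measurableT_comp (measurable_powR _)); exact: measurableT_comp.
have p'0 : 0 < p / (p - 1) by rewrite divr_gt0.
have := @hoelder _ _ _ mu _ _ _ _ mh my p'0 p0.
rewrite Lnorm1 => /(_ _)/le_trans H.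
have -> : (\int[mu]_t (h t * `|(y : T -> R) t|)%:E =
    \int[mu]_t `|(h \* (y : T -> R)) t|%:E)%E.
  by apply: eq_integral => t _; rewrite normrM ger0_norm// powR_ge0.
apply: H; first by field; rewrite !gt_eqF.
rewrite -Lspace_EFin_norm [leRHS]EFinM; apply: lee_wpmul2r; first by rewrite lee_fin.
rewrite unlock invf_div le_eqVlt; apply/orP; left; apply/eqP.
have -> : (\int[mu]_t (`|(EFin \o h) t| `^ (p / (p - 1))) = (`|x| `^ p)%:E)%E.
  rewrite Lspace_norm_powR; apply: eq_integral => t _.
  rewrite /= ger0_norm ?powR_ge0// -powRrM.
  by congr ((_ `^ _)%:E); field; rewrite gt_eqF.
rewrite poweR_EFin -powRrM; congr ((_ `^ _)%:E); field.
by rewrite gt_eqF.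
Qed.

(** For [1 < p], the Gateaux derivative of [fun x => `|x| `^ p] at [x] in the direction [y]. *)
Definition dnorm_powR x y : R :=
  \int[mu]_t (dpow p ((x : T -> R) t) * (y : T -> R) t).

Hypothesis p_gt1 : 1 < p.
Hypothesis p_le2 : p <= 2.

Lemma measurable_pairing x y :
  measurable_fun setT (fun t => dpow p ((x : T -> R) t) * (y : T -> R) t).
Proof.
apply: measurable_funM; last exact: Lspace_measurable.
by apply: (measurableT_comp (measurable_dpow _)); exact: Lspace_measurable.
Qed.

(** The Hoelder continuity of [dpow p] integrates to that of [dnorm_powR]. The
    difference [x - v] is passed as a separate class [z], since its
    representative agrees only almost everywhere with the difference of
    the representatives. *)
Let le_pairing x v y (z : L) : z = x - v ->
 (\int[mu]_t `|dpow p ((x : T -> R) t) * (y : T -> R) t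
   - dpow p ((v : T -> R) t) * (y : T -> R) t|%:E
  <= (2 * p * `|z| `^ (p - 1) * `|y|)%:E)%E.
Proof.
move=> zE; have p0 := p1.
have mx := @Lspace_measurable _ _ _ _ _ _ x.
have mv := @Lspace_measurable _ _ _ _ _ _ v.
have my := @Lspace_measurable _ _ _ _ _ _ y.
have mz := @Lspace_measurable _ _ _ _ _ _ z.
have mzy : measurable_fun setT
    (fun t => `|(z : T -> R) t| `^ (p - 1) * `|(y : T -> R) t|).
  apply: measurable_funM; last exact: measurableT_comp.
  by apply: (measurableT_comp (measurable_powR _)); exact: measurableT_comp.
have zt : \forall t \ae mu, (z : T -> R) t = (x : T -> R) t - (v : T -> R) t.
  have := LspaceD_ae z v; rewrite zE subrK -zE.
  by apply: filterS => t /(_ I) ->; rewrite /= addrK.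
apply: (@le_trans _ _ (\int[mu]_t ((2 * p)%:E *
    (`|(z : T -> R) t| `^ (p - 1) * `|(y : T -> R) t|)%:E))%E).
  apply: ae_ge0_le_integral => //.
  - apply/measurable_EFinP; apply: measurableT_comp => //.
    by apply: measurable_funB; exact: measurable_pairing.
  - by move=> u _; rewrite -EFinM lee_fin !mulr_ge0 ?powR_ge0//; lra.
  - by apply: emeasurable_funM => //; exact/measurable_EFinP.
  apply: filterS zt => u zu _; rewrite -EFinM lee_fin -mulrBl normrM zu mulrA.
  by rewrite ler_wpM2r// dpow_holder.
rewrite ge0_integralZl//; last 2 first.
- exact/measurable_EFinP.
- by rewrite lee_fin; lra.
rewrite -mulrA [leRHS]EFinM; apply: lee_wpmul2l; first by rewrite lee_fin; lra.
exact: Lspace_hoelder.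
Qed.

Lemma integrable_pairing x y :
  mu.-integrable setT
    (fun t => (dpow p ((x : T -> R) t) * (y : T -> R) t)%:E).
Proof.
apply/integrableP; split; first exact/measurable_EFinP/measurable_pairing.
apply: le_lt_trans (ltry (2 * p * `|x| `^ (p - 1) * `|y|)).
apply: le_trans (@le_pairing x 0 y x _); last by rewrite subr0.
apply: ae_ge0_le_integral => //.
- by apply/measurable_EFinP/measurableT_comp => //; exact: measurable_pairing.
- apply/measurable_EFinP; apply: measurableT_comp => //.
  by apply: measurable_funB; exact: measurable_pairing.
apply: filterS (Lspace0_ae mu p_ge1) => t /(_ I) -> _ /=.
by rewrite /(dpow p 0) sgr0 mulr0 !mul0r subr0.
Qed.

Lemma dnorm_powR_holder x v y :
  `|dnorm_powR x y - dnorm_powR v y| <= 2 * p * `|x - v| `^ (p - 1) * `|y|.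
Proof.
rewrite /dnorm_powR -RintegralB//; [|exact: integrable_pairing..].
have iB : mu.-integrable setT (EFin \o (fun t =>
   dpow p ((x : T -> R) t) * (y : T -> R) t
   - dpow p ((v : T -> R) t) * (y : T -> R) t)).
  exact: (integrableB measurableT (integrable_pairing x y)
    (integrable_pairing v y)).
rewrite -lee_fin EFin_normr_Rintegral//.
apply: le_trans (le_pairing y erefl).
by apply: le_trans (le_abse_integral _ _ _) _ => //; case/integrableP: iB.
Qed.

Lemma norm_dnorm_powR x y :
  `|dnorm_powR x y| <= 2 * p * `|x| `^ (p - 1) * `|y|.
Proof.
have := dnorm_powR_holder x 0 y; rewrite subr0.
suff -> : dnorm_powR 0 y = 0 by rewrite subr0.
rewrite /dnorm_powR /Rintegral (ae_eq_integral (cst 0%E)) ?integral0//.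
  exact/measurable_EFinP/measurable_pairing.
apply: filterS (Lspace0_ae mu p_ge1) => t /(_ I) -> _ /=.
by rewrite /dpow sgr0 mulr0 !mul0r.
Qed.

Lemma dnorm_powR_linear x : scalar (dnorm_powR x).
Proof.
move=> a y z; rewrite /dnorm_powR.
rewrite -RintegralZl//; last exact: integrable_pairing.
rewrite -RintegralD//; last 2 first.
- rewrite (_ : _ \o _ = (fun t => a%:E *
    (dpow p ((x : T -> R) t) * (y : T -> R) t)%:E)%E)//.
  by apply: integrableZl => //; exact: integrable_pairing.
- exact: integrable_pairing.
rewrite /Rintegral; congr fine; apply: ae_eq_integral => //.
- exact/measurable_EFinP/measurable_pairing.
- apply/measurable_EFinP/measurable_funD; last exact: measurable_pairing.
  by apply: measurable_funM => //; exact: measurable_pairing.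
apply: filterS2 (LspaceD_ae (a *: y) z) (LspaceZ_ae a y).
by move=> t /(_ I) -> /(_ I) /= -> _; congr EFin; ring.
Qed.

(** The scalar inequality [norm_powR_smooth], integrated over [T]. *)
Lemma Lspace_smooth x y :
  `|x + y| `^ p <= `|x| `^ p + dnorm_powR x y + Ctilde p * `|y| `^ p.
Proof.
have ix := Lspace_integrable x; have iy := Lspace_integrable y.
have ixy := integrable_pairing x y.
have iCy : mu.-integrable setT
    (fun t => (Ctilde p)%:E * (`|(y : T -> R) t| `^ p)%:E)%E.
  exact: integrableZl.
rewrite -lee_fin !EFinD EFinM !Lspace_norm_powR.
rewrite /dnorm_powR /Rintegral fineK; last exact: integrable_fin_num.
rewrite -integralZl// -integralD// -integralD//; last exact: integrableD.
have [[/integrableP[mix _] /integrableP[mixy _]] /integrableP[miCy _]] :=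
  ((ix, ixy), iCy).
have pw t : `|(x : T -> R) t + (y : T -> R) t| `^ p <=
    `|(x : T -> R) t| `^ p + dpow p ((x : T -> R) t) * (y : T -> R) t
    + Ctilde p * `|(y : T -> R) t| `^ p by exact: norm_powR_smooth.
apply: ae_ge0_le_integral => //.
- apply/measurable_EFinP; apply: (measurableT_comp (measurable_powR _)).
  by apply: measurableT_comp => //; exact: Lspace_measurable.
- move=> t _; rewrite -EFinM -!EFinD lee_fin.
  by rewrite (le_trans _ (pw t))// powR_ge0.
- exact: (emeasurable_funD (emeasurable_funD mix mixy) miCy).
apply: filterS (LspaceD_ae x y) => t /(_ I) -> _ /=.
by rewrite -EFinM -!EFinD lee_fin.
Qed.

End Lspace_tangent.

(** * Centred perturbations of nonnegative integrands *)

Section centered.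
Context d (T : measurableType d) (R : realType).
Variable mu : {measure set T -> \bar R}.

(** A centred error term does not contribute to the integral, even when the
    bounding integral is infinite. *)
Lemma ge0_le_integral_centered (D : set T) (a b g : T -> R) :
  measurable D -> measurable_fun D a -> measurable_fun D b ->
  (forall t, D t -> 0 <= a t) -> (forall t, D t -> 0 <= b t) ->
  mu.-integrable D (EFin \o g) -> (\int[mu]_(t in D) (g t)%:E = 0)%E ->
  (forall t, D t -> a t <= b t + g t) ->
  (\int[mu]_(t in D) (a t)%:E <= \int[mu]_(t in D) (b t)%:E)%E.
Proof.
move=> mD ma mb a0 b0 ig g0 abg.
have [->|boo] := eqVneq (\int[mu]_(t in D) (b t)%:E)%E +oo%E; first exact: leey.
have ib : mu.-integrable D (EFin \o b).
  apply/integrableP; split; first exact/measurable_EFinP.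
  rewrite (eq_integral (EFin \o b)) ?ltey// => t /[!inE] Dt.
  by rewrite /= ger0_norm// b0.
have -> : (\int[mu]_(t in D) (b t)%:E =
    \int[mu]_(t in D) ((b t)%:E + (g t)%:E))%E.
  by rewrite integralD// g0 adde0.
apply: ge0_le_integral => //.
- exact/measurable_EFinP.
- have /integrableP[mg _] := ig; apply: emeasurable_funD => //.
  exact/measurable_EFinP.
Qed.

End centered.

(** * Functionals of random vectors *)

Section vectors.
Context d (Omega : measurableType d) (R : realType) (V : normedModType R).
Variable P : probability Omega R.
Implicit Types (X Y S : Omega -> V) (phi : {scalar V}).

Lemma scalar_bounded_continuous phi (K : R) :
  (forall y, `|phi y| <= K * `|y|) -> continuous (phi : V -> R).
Proof.
move=> phiK x; apply/cvgrPdist_lt => e e0.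
have K1 : 0 < `|K| + 1 by rewrite ltr_pwDr.
near=> y; rewrite -raddfB; apply: le_lt_trans (phiK _) _.
apply: (@le_lt_trans _ _ ((`|K| + 1) * `|x - y|)).
  by rewrite ler_wpM2r// (le_trans (ler_norm K))// lerDl.
rewrite -ltr_pdivlMl//; near: y.
by apply: cvgr_dist_lt => //; rewrite mulr_gt0// invr_gt0.
Unshelve. all: by end_near. Qed.

Lemma open_borel (U : set V) : open U -> borel U.
Proof. exact: sub_sigma_algebra. Qed.

Lemma borel_setD (A B : set V) : borel A -> borel B -> borel (A `\` B).
Proof.
move=> mA mB.
exact: (@measurableD _ (g_sigma_algebraType [set U : set V | open U]) A B mA mB).
Qed.

Lemma borel_seqDU (F : (set V)^nat) n :
  (forall k, borel (F k)) -> borel (seqDU F n).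
Proof.
move=> bF; apply: borel_setD => //.
apply: (@bigsetU_measurable _ (g_sigma_algebraType [set U : set V | open U])).
by move=> k _; exact: bF.
Qed.

Lemma continuous_random_vector (f : V -> R) X :
  continuous f -> random_vector X -> measurable_fun setT (f \o X).
Proof.
move=> /continuousP cf [mX _].
apply: (measurability _ (RGenOpens.measurableE R)).
move=> _ [_ [a [b ->] <-]]; rewrite setTI comp_preimage.
by apply: (mX _); apply: open_borel; exact/cf/interval_open.
Qed.

Lemma measurable_norm_random_vector X :
  random_vector X -> measurable_fun setT (fun w => `|X w|).
Proof. by apply: continuous_random_vector; exact: norm_continuous. Qed.

(** Sums of random vectors need not be Borel measurable without a separability
    argument; when one summand takes finitely many values it suffices to cut
    along these values, for instance with [F v w = `|v - X w|]. *)
Lemma measurable_simple_vector d' (W : measurableType d')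
    (F : V -> Omega -> W) Y : simple_vector Y ->
  (forall v, measurable_fun setT (F v)) ->
  measurable_fun setT (fun w => F (Y w) w).
Proof.
move=> [finY mY] mF _ B mB; rewrite setTI.
rewrite (_ : _ @^-1` B =
    \bigcup_(v in range Y) (Y @^-1` [set v] `&` F v @^-1` B)).
  apply: fin_bigcup_measurable => // v _; apply: measurableI => //.
  by rewrite -[X in measurable X]setTI; exact: mF.
apply/seteqP; split=> [w Bw|w [v _ [/= <-]]//].
by exists (Y w); [exists w|].
Qed.

Lemma integral_simple_vector phi Y : simple_vector Y ->
  P.-integrable setT (fun w => (phi (Y w))%:E) /\
  (\int[P]_w (phi (Y w))%:E = (phi (simple_expectation P Y))%:E)%E.
Proof.
move=> [finY mY].
pose F v w := ((phi v)%:E * (\1_(Y @^-1` [set v]) w)%:E)%E.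
have iF v : P.-integrable setT (F v).
  apply: integrableZl => //.
  exact: integrable_indic.
pose r := finmap.enum_fset (fset_set (range Y)).
have YE w : (phi (Y w))%:E = (\sum_(v <- r) F v w)%E.
  rewrite (bigD1_seq (Y w))/= ?finmap.fset_uniq//; last first.
    by rewrite in_fset_set// inE; exists w.
  rewrite big1 ?adde0; first by rewrite /F indicE mem_set// mule1.
  move=> v vY; rewrite /F indicE memNset ?mule0//= => Ywv.
  by rewrite Ywv eqxx in vY.
split.
  under eq_fun do rewrite YE.
  by apply: integrable_sum => //.
under eq_integral do rewrite YE.
rewrite integral_sum// /simple_expectation fsbig_finite//= linear_sum -sumEFin.
apply: eq_bigr => v _; rewrite integralZl//; last exact: integrable_indic.
rewrite integral_indic// setIT. rewrite scalarZ/= EFinM muleC fineK//.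
exact: fin_num_measure.
Qed.

(** Bounded functionals commute with Bochner expectations: they do so for simple
    vectors, and both sides are continuous along the approximating sequence. *)
Lemma expectation_functional phi (K : R) X v :
  (forall y, `|phi y| <= K * `|y|) ->
  (\int[P]_w `|X w|%:E < +oo)%E -> has_expectation P X v ->
  (\int[P]_w (phi (X w))%:E = (phi v)%:E)%E.
Proof.
move=> phiK Xoo [mX [Y [sY /fine_cvgP[Yfin Y0] Yv]]].
have K0 : 0 <= `|K| by [].
have {}phiK y : `|phi y| <= `|K| * `|y|.
  by apply: le_trans (phiK y) _; rewrite ler_wpM2r// ler_norm.
have cphi := scalar_bounded_continuous phiK.
have mphiX : measurable_fun setT (fun w => phi (X w)).
  exact: continuous_random_vector.
have mNX := measurable_norm_random_vector mX.
have iphiX : P.-integrable setT (fun w => (phi (X w))%:E).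
  apply: (@le_integrable _ _ _ _ _ _ _ (fun w => (`|K|%:E * `|X w|%:E)%E)) => //.
  - exact/measurable_EFinP.
  - by move=> w _; rewrite -EFinM !abse_EFin lee_fin [leRHS]ger0_norm// mulr_ge0.
  apply: integrableZl => //; apply/integrableP; split; first exact/measurable_EFinP.
  by under eq_integral do rewrite abse_EFin normr_id.
have /fineK cE := integrable_fin_num measurableT iphiX.
rewrite -cE; move: (fine _) cE => c cE; congr EFin; apply/eqP; rewrite -subr_eq0 -normr_eq0.
rewrite eq_le normr_ge0 andbT; apply/ler_addgt0Pr => e e0; rewrite add0r.
pose e' := e / (2 * (`|K| + 1)).
have e'0 : 0 < e' by rewrite divr_gt0// mulr_gt0// ltr_pwDr.
have [n [Yfn Yn vn]] : exists n,
    [/\ ('E_P[fun w => (`|Y n w - X w|)%R])%E \is a fin_num,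
        fine ('E_P[fun w => (`|Y n w - X w|)%R])%E < e' &
        `|v - simple_expectation P (Y n)| < e'].
  have h1 := cvgr_lt 0 Y0 e' e'0.
  have /cvgrPdist_lt/(_ e' e'0) h2 := Yv.
  by have [n _ nP] := filterI (filterI Yfin (h1 _)) h2; exists n; have [[]] := nP n (leqnn n).
have mYX : measurable_fun setT (fun w => `|Y n w - X w|).
  apply: (@measurable_simple_vector _ _ (fun u w => `|u - X w|)) => // u.
  apply: (@continuous_random_vector (fun x => `|u - x|)) => // x.
  by apply: cvg_norm; apply: cvgB => //; exact: cvg_cst.
have [iphiY phiYE] := integral_simple_vector phi (sY n).
have h1 : `|phi (simple_expectation P (Y n)) - c| <= `|K| * e'.
  rewrite -lee_fin -abse_EFin EFinB -phiYE cE -integralB_EFin//.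
  apply: le_trans (le_abse_integral _ _ _) _ => //.
    apply/measurable_EFinP/measurable_funB => //.
    by have /integrableP[/measurable_EFinP] := iphiY.
  apply: (@le_trans _ _ (\int[P]_w (`|K|%:E * `|Y n w - X w|%:E))%E).
    apply: ge0_le_integral => //.
    - apply: measurableT_comp => //; apply/measurable_EFinP/measurable_funB => //.
      by have /integrableP[/measurable_EFinP] := iphiY.
    - by apply: measurable_funeM; apply/measurable_EFinP.
    - by move=> w _; rewrite abse_EFin -EFinM lee_fin -raddfB; exact: phiK.
  rewrite ge0_integralZl_EFin//; last exact/measurable_EFinP.
  rewrite EFinM lee_wpmul2l// ?lee_fin//.
  by move: Yfn Yn; rewrite unlock => /fineK <- /ltW; rewrite lee_fin.
have h2 : `|phi v - phi (simple_expectation P (Y n))| <= `|K| * e'.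
  by rewrite -raddfB (le_trans (phiK _))// ler_wpM2l// ltW.
rewrite distrC (le_trans (ler_distD (phi (simple_expectation P (Y n))) _ _))//.
apply: le_trans (lerD h2 h1) _.
have -> : e = (`|K| + 1) * e' + (`|K| + 1) * e'.
  by rewrite /e'; field; rewrite gt_eqF// ltr_pwDr.
by apply: lerD; rewrite ler_wpM2r// ?ltW// ltrDl.
Qed.

End vectors.

(** * Martingales in smooth spaces *)

(** [C]-smoothness of the [p]-th power of the norm with one functional serving a
    whole ball of base points, up to a small linear error; the radius of the
    ball is uniform. Only countably many functionals are then needed along a
    random vector with separable range. *)
Definition almost_tangent (R : realType) (p C : R) (V : normedModType R) :=
  forall eps : R, 0 < eps -> exists2 delta : R, 0 < delta &
  forall v : V, exists2 phi : {scalar V},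
    exists K : R, forall y, `|phi y| <= K * `|y| &
    forall x y, `|v - x| < delta ->
      `|x + y| `^ p <= `|x| `^ p + phi y + eps * `|y| + C * `|y| `^ p.

Section martingale.
Context d (Omega : measurableType d) (R : realType) (V : normedModType R).
Variable P : probability Omega R.
Implicit Types (X Y S : Omega -> V).

Lemma measurable_norm_powR (p : R) X : random_vector X ->
  measurable_fun setT (fun w => `|X w| `^ p).
Proof.
move=> rX; apply: (measurableT_comp (measurable_powR _)).
exact: measurable_norm_random_vector.
Qed.

(** Conditional centredness of [X] given [S], seen through one fixed bounded
    functional. The condition provides a common Bochner expectation [v] for
    [X] and for [0] restricted to the event; the latter shows [phi v = 0]. *)
Lemma cond_expectation0_functional X S (phi : {scalar V}) (K : R) (B : set V) :
  (forall y, `|phi y| <= K * `|y|) ->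
  random_vector S -> random_vector X -> (\int[P]_w `|X w|%:E < +oo)%E ->
  is_cond_expectation P X (sigma_rv S) (cst 0) -> borel B ->
  P.-integrable (S @^-1` B) (EFin \o (phi \o X)) /\
  (\int[P]_(w in S @^-1` B) (phi (X w))%:E = 0)%E.
Proof.
move=> phiK rS rX Xoo [_ cX0] bB.
have mB : measurable (S @^-1` B) by case: rS => mS _; exact: mS.
have mNX := measurable_norm_random_vector rX.
have mphiX : measurable_fun setT (phi \o X).
  apply: continuous_random_vector => //.
  exact: (scalar_bounded_continuous phiK).
split.
  apply: (@integrableS _ _ _ _ setT) => //.
  apply: (@le_integrable _ _ _ _ _ _ _ (fun w => (K%:E * `|X w|%:E)%E)) => //.
  - exact/measurable_EFinP.
  - move=> w _; rewrite -EFinM !abse_EFin lee_fin.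
    by rewrite (le_trans (phiK _))// ler_norm.
  apply: integrableZl => //; apply/integrableP; split; first exact/measurable_EFinP.
  by under eq_integral do rewrite abse_EFin normr_id.
have SB : sigma_rv S (S @^-1` B) by exists B => //; rewrite setTI.
have [v [hX h0]] := cX0 _ SB.
have E0 : (\int[P]_w (phi (restrict_event (S @^-1` B) (cst 0) w))%:E
           = (phi v)%:E)%E.
  apply: (expectation_functional phiK _ h0).
  rewrite integral0_eq// => w _.
  by rewrite /restrict_event scaler0 normr0.
have phiv : phi v = 0.
  apply: EFin_inj; rewrite -E0 integral0_eq// => w _.
  by rewrite /restrict_event scaler0 raddf0.
have : (\int[P]_w (phi (restrict_event (S @^-1` B) X w))%:E = (phi v)%:E)%E.
  apply: (expectation_functional phiK _ hX).
  apply: le_lt_trans Xoo; apply: ge0_le_integral => //.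
  - by apply/measurable_EFinP; apply: measurable_norm_random_vector; case: hX.
  - exact/measurable_EFinP.
  move=> w _; rewrite lee_fin /restrict_event indicE normrZ.
  by case: (_ \in _); rewrite ?normr1 ?mul1r// normr0 mul0r.
rewrite phiv; apply: etrans; rewrite integral_mkcond; apply: eq_integral => w _.
rewrite patchE /restrict_event indicE.
by case: (w \in _); rewrite ?scale1r// scale0r raddf0.
Qed.

(** A functional depending measurably on [S] cannot be averaged against [X]
    directly. Instead the sample space is cut into countably many events of the
    sigma-algebra of [S], on each of which [S] stays in a small ball and one
    fixed functional is an approximate tangent; it averages out on that event.
    Summing over the events leaves an error [eps * E |X|] with [eps]
    arbitrary. *)
Lemma smooth_centered_step (p C : R) S X : 0 <= C -> almost_tangent p C V ->
  random_vector S -> random_vector X -> random_vector (S \+ X) ->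
  (\int[P]_w `|X w|%:E < +oo)%E ->
  is_cond_expectation P X (sigma_rv S) (cst 0) ->
  (\int[P]_w (`|S w + X w| `^ p)%:E <=
   \int[P]_w (`|S w| `^ p)%:E + C%:E * \int[P]_w (`|X w| `^ p)%:E)%E.
Proof.
move=> C0 tgt rS rX rSX Xoo cX0.
have mNX := measurable_norm_random_vector rX.
have mSp := measurable_norm_powR p rS.
have mXp := measurable_norm_powR p rX.
have mSXp := measurable_norm_powR p rSX.
have NX0 : (0 <= \int[P]_w `|X w|%:E)%E by apply: integral_ge0 => w _; rewrite lee_fin.
apply/lee_addgt0Pr => e e0.
pose m := fine (\int[P]_w `|X w|%:E)%E.
have mE : (\int[P]_w `|X w|%:E = m%:E)%E by rewrite fineK// ge0_fin_numE.
have m0 : 0 <= m by rewrite fine_ge0.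
pose eps := e / (m + 1).
have eps0 : 0 < eps by rewrite divr_gt0// ltr_pwDr.
have [delta delta0 near_tgt] := tgt eps eps0.
have [_ [D cD SD]] := rS.
have /countable_injP[code code_inj] := cD.
(* An enumeration of the dense set [D]; unused codes are sent to [0]. *)
pose v k := xget 0 (D `&` code @^-1` [set k]).
pose U k := [set x : V | `|v k - x| < delta].
have bU k : borel (U k).
  apply: open_borel; rewrite (_ : U k = ball (v k) delta); first exact: ball_open.
  by rewrite -ball_normE.
pose B := seqDU U.
have bB k : borel (B k) by exact: borel_seqDU.
pose A k := S @^-1` B k.
have mA k : measurable (A k) by case: (rS) => mS _; exact: mS.
have AT : \bigcup_k A k = setT.
  rewrite -preimage_bigcup -seqDU_bigcup_eq; apply/seteqP; split => // w _.
  have /(_ _ (nbhsx_ballx _ _ delta0))[z [Dz Sz]] : closure D (S w).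
    by apply: SD; exists w.
  exists (code z) => //=; rewrite /U /=.
  have -> : v (code z) = z.
    rewrite /v; case: xgetP => [y _ [/= Dy /code_inj]|/(_ z)[]//].
    by apply; rewrite inE.
  by rewrite distrC; move: Sz; rewrite -ball_normE.
have tA : trivIset setT A.
  move=> i j _ _ [w [Bi Bj]]; apply: (@trivIset_seqDU _ U) => //.
  by exists (S w).
pose a w := `|S w + X w| `^ p.
pose b w := `|S w| `^ p + eps * `|X w| + C * `|X w| `^ p.
have b0 w : 0 <= b w.
  by rewrite addr_ge0 ?addr_ge0 ?powR_ge0//; apply: mulr_ge0;
    rewrite ?powR_ge0 ?(ltW eps0).
have mb : measurable_fun setT b.
  apply: measurable_funD; last exact: measurable_funM.
  by apply: measurable_funD => //; exact: measurable_funM.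
have abA k : (\int[P]_(w in A k) (a w)%:E <= \int[P]_(w in A k) (b w)%:E)%E.
  have [phi [K phiK] phiT] := near_tgt (v k).
  have [iphi phi0] := cond_expectation0_functional phiK rS rX Xoo cX0 (bB k).
  apply: (ge0_le_integral_centered _ _ _ _ _ iphi phi0) => //.
  - exact: mA.
  - exact: measurable_funTS.
  - exact: measurable_funTS.
  - by move=> w _; exact: powR_ge0.
  move=> w [Uw _]; rewrite /b /= addrAC (addrAC _ (eps * _)).
  exact: phiT.
have intAT (f : Omega -> R) : measurable_fun setT f -> (forall w, 0 <= f w) ->
    (\int[P]_w (f w)%:E = \sum_(0 <= k <oo) \int[P]_(w in A k) (f w)%:E)%E.
  move=> mf f0; rewrite -AT ge0_integral_bigcup//.
  - by rewrite AT; exact/measurable_EFinP.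
  - by move=> w _; rewrite lee_fin.
apply: (@le_trans _ _ (\int[P]_w (b w)%:E)%E).
  rewrite (intAT _ mb b0) (intAT _ mSXp (fun w => powR_ge0 _ _)).
  apply: lee_nneseries => // k _ _.
  by apply: integral_ge0 => w _; rewrite lee_fin powR_ge0.
rewrite /b; under eq_integral do rewrite !EFinD !EFinM.
have mNX' : measurable_fun setT (fun w => eps%:E * `|X w|%:E)%E.
  by apply: measurable_funeM; exact/measurable_EFinP.
have mXp' : measurable_fun setT (fun w => C%:E * (`|X w| `^ p)%:E)%E.
  by apply: measurable_funeM; exact/measurable_EFinP.
have mSp' : measurable_fun setT (fun w => (`|S w| `^ p)%:E).
  exact/measurable_EFinP.
have n1 w : (0 <= eps%:E * `|X w|%:E)%E by rewrite -EFinM lee_fin mulr_ge0// ltW.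
have n2 w : (0 <= C%:E * (`|X w| `^ p)%:E)%E.
  by rewrite -EFinM lee_fin mulr_ge0// powR_ge0.
have n3 w : (0 <= (`|S w| `^ p)%:E)%E by rewrite lee_fin powR_ge0.
rewrite ge0_integralD//; last 2 first.
- by move=> w _; rewrite adde_ge0.
- exact: emeasurable_funD.
rewrite ge0_integralD// !ge0_integralZl_EFin ?(ltW eps0)//; last 2 first.
- exact/measurable_EFinP.
- exact/measurable_EFinP.
rewrite -addeA (addeC (eps%:E * _)%E) addeA; apply: leeD => //.
rewrite mE -EFinM lee_fin /eps -mulrA ler_piMr ?(ltW e0)//.
by rewrite mulrC ler_pdivrMr ?ltr_pwDr// mul1r lerDl.
Qed.

Lemma v_martingale_smooth (p C : R) (n : nat) (S : nat -> Omega -> V) :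
  0 <= C -> almost_tangent p C V -> v_martingale P n S -> (1 <= n)%N ->
  ('E_P[fun w => (`|S n w| `^ p)%R] <=
   'E_P[fun w => (`|mdiff S 1 w| `^ p)%R] +
   C%:E * \sum_(2 <= j < n.+1) 'E_P[fun w => (`|mdiff S j w| `^ p)%R])%E.
Proof.
move=> C0 tgt [rS mS] n1.
suff H : forall j, (1 <= j <= n)%N -> ('E_P[fun w => (`|S j w| `^ p)%R] <=
   'E_P[fun w => (`|mdiff S 1 w| `^ p)%R] +
   C%:E * \sum_(2 <= i < j.+1) 'E_P[fun w => (`|mdiff S i w| `^ p)%R])%E.
  by apply: H; rewrite n1 leqnn.
elim=> // -[_ _|j IH jn].
  rewrite big_geq// mule0 adde0.
  by under [in leRHS]eq_fun do rewrite /mdiff/= subr0.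
have /mS[Xoo cX0] : (2 <= j.+2 <= n)%N by [].
have jn' : (1 <= j.+1 <= n)%N by rewrite /= ltnW.
have ST w : S j.+2 w = S j.+1 w + mdiff S j.+2 w by rewrite /mdiff/= subrKC.
(* Measurability of the difference is read off from the Bochner expectation
   on the sure event. *)
have rX : random_vector (mdiff S j.+2).
  have [_ cX] := cX0.
  have [|v [[rX _] _]] := cX setT.
    exists setT; last by rewrite setTI preimage_setT.
    by apply: open_borel; exact: openT.
  suff <- : restrict_event setT (mdiff S j.+2) = mdiff S j.+2 by [].
  by apply/funext => w; rewrite /restrict_event indicT scale1r.
have rSX : random_vector (S j.+1 \+ mdiff S j.+2).
  by rewrite (_ : _ \+ _ = S j.+2); [exact: rS|apply/funext => w; rewrite ST].
have := IH jn'; move: Xoo; rewrite unlock => Xoo IH'.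
have := smooth_centered_step C0 tgt (rS _ jn') rX rSX Xoo cX0.
under eq_integral do rewrite -ST.
move=> /le_trans; apply.
have E0 i : (0 <= \int[P]_w (`|mdiff S i w| `^ p)%:E)%E.
  by apply: integral_ge0 => w _; rewrite lee_fin powR_ge0.
rewrite [in leRHS]big_nat_recr//= (ge0_muleDr _ (sume_ge0 _ _) (E0 _))//.
by rewrite addeA leeD2r.
Qed.

End martingale.

(** * Upper bound for the spaces of p-integrable functions *)

Section Lspace_main.
Context d (T : measurableType d) (R : realType).
Variables (mu : {measure set T -> \bar R}) (p : R) (p_ge1 : (1 <= p%:E)%E).
Local Notation L := (LspaceType mu p_ge1).

Lemma Lspace_almost_tangent : 1 < p -> p <= 2 ->
  almost_tangent p (Ctilde p) L.
Proof.
move=> p1 p2 eps eps0; have q0 : 0 < p - 1 by lra.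
have [K KE K0] : exists2 K, K = 2 * p & 0 < K by exists (2 * p) => //; lra.
(* The radius at which the Hoelder bound [K * delta `^ (p - 1)] equals [eps]. *)
exists ((eps / K) `^ (p - 1)^-1); first by apply: powR_gt0; exact: divr_gt0.
move=> v.
pose phi : {scalar L} := HB.pack (dnorm_powR v)
  (GRing.isLinear.Build R L R *%R (dnorm_powR v) (dnorm_powR_linear p1 p2 v)).
exists phi; first by exists (2 * p * `|v| `^ (p - 1)); exact: norm_dnorm_powR.
move=> x y vx; apply: le_trans (Lspace_smooth p1 p2 x y) _.
rewrite lerD2r -addrA lerD2l -lerBlDl.
apply: le_trans (ler_norm _) _.
apply: le_trans (dnorm_powR_holder p1 p2 x v y) _.
rewrite ler_wpM2r// -KE -ler_pdivlMl// mulrC distrC.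
have -> : eps / K = ((eps / K) `^ (p - 1)^-1) `^ (p - 1).
  by rewrite -powRrM mulVf ?gt_eqF// powRr1// divr_ge0// ltW.
by rewrite ge0_ler_powR ?nnegrE ?powR_ge0// ltW.
Qed.

Lemma Lspace_completely_smooth : 1 < p -> p <= 2 ->
  completely_smooth p (Ctilde p `^ p^-1) L.
Proof.
move=> p1 p2; have C1 := Ctilde_ge1 p1 p2; have C0 : 0 < Ctilde p by lra.
split; first by rewrite powR_gt0.
move=> d' Omega P X iX; rewrite unlock => X0 x y.
have -> : (Ctilde p `^ p^-1) `^ p = Ctilde p.
  by rewrite -powRrM mulVf ?powRr1 ?ltW// gt_eqF//; lra.
have mX : measurable_fun setT X by exact: measurable_funPT.
have mXp : measurable_fun setT (fun w => `|X w| `^ p).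
  by apply: (measurableT_comp (measurable_powR _)); exact: measurableT_comp.
pose b w := `|x| `^ p + (Ctilde p * `|y| `^ p) * `|X w| `^ p.
have y0 : 0 <= Ctilde p * `|y| `^ p by rewrite mulr_ge0 ?powR_ge0// ltW.
have le_b : (\int[P]_w (`|x + X w *: y| `^ p)%:E <= \int[P]_w (b w)%:E)%E.
  apply: (@ge0_le_integral_centered _ _ _ _ _ _ _
    (fun w => X w * dnorm_powR x y)) => //.
  - apply: (measurableT_comp (measurable_powR _)).
    apply: (@measurableT_comp _ _ _ _ _ _ (fun r : R => `|x + r *: y|)) => //.
    apply: continuous_measurable_fun => r; apply: cvg_norm; apply: cvgD.
      exact: cvg_cst.
    exact: scalel_continuous.
  - by apply: measurable_funD => //; exact: measurable_funM.
  - by move=> w _; rewrite addr_ge0 ?powR_ge0// mulr_ge0// powR_ge0.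
  - rewrite (_ : _ \o _ = (fun w => (X w)%:E * (dnorm_powR x y)%:E)%E)//.
    exact: integrableZr.
  - under eq_integral do rewrite EFinM.
    by rewrite integralZr// X0 mul0e.
  move=> w _; apply: le_trans (Lspace_smooth p1 p2 x (X w *: y)) _.
  have -> : dnorm_powR x (X w *: y) = X w * dnorm_powR x y.
    have x0 : dnorm_powR x 0 = 0.
      have := norm_dnorm_powR p1 p2 x 0.
      by rewrite normr0 mulr0 normr_le0 => /eqP.
    by have := dnorm_powR_linear p1 p2 x (X w) y 0; rewrite !addr0 x0 addr0.
  by rewrite normrZ powRM// /b; lra.
apply: (le_trans le_b); rewrite /b; under eq_integral do rewrite EFinD.
rewrite ge0_integralD//; last 2 first.
- by move=> w _; rewrite lee_fin mulr_ge0// powR_ge0.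
- by apply/measurable_EFinP; exact: measurable_funM.
rewrite integral_cst//= probability_setT mule1; apply: leeD => //.
under eq_integral do rewrite EFinM.
rewrite ge0_integralZl_EFin//; last exact/measurable_EFinP.
by rewrite EFinM muleAC.
Qed.

End Lspace_main.

(** * Optimality of the constant *)

Lemma bernoulli_centered (R : realType) (s t : R) : 0 < s -> 0 < t ->
  let X (b : bool) := if b then - s else t in
  (\int[bernoulli_prob (t / (s + t))]_b (X b)%:E = 0)%E.
Proof.
move=> s0 t0 X; have st0 : 0 < s + t by lra.
have e01 : 0 <= t / (s + t) <= 1.
  by rewrite divr_ge0 ?ler_pdivrMr ?mul1r//; lra.
(* The shift by [s] makes the integrand nonnegative. *)
have -> : (\int[bernoulli_prob (t / (s + t))]_b (X b)%:E =
    \int[bernoulli_prob (t / (s + t))]_b ((X b + s)%:E - s%:E))%E.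
  by apply: eq_integral => b _; rewrite -EFinB addrK.
have X0 b : (0 <= (X b + s)%:E)%E by rewrite lee_fin /X; case: b; lra.
rewrite integralB_EFin//.
- rewrite integral_cst//= probability_setT mule1 integral_bernoulli_prob//.
  rewrite /X /= -!EFinM -!EFinD /unstable.onem; congr EFin; field.
  by rewrite gt_eqF.
- apply/integrableP; split => //.
  by rewrite integral_bernoulli_prob//= -!EFinM -EFinD ltry.
- exact: finite_measure_integrable_cst.
Qed.

(** Smoothness along the line spanned by [f], tested on the variable with values
    [- s] and [t], of probabilities [t / (s + t)] and [s / (s + t)]; the
    common factor [`|f| `^ p / (s + t)] is then cancelled. *)
Lemma completely_smooth_two_point (R : realType) (p D : R)
    (V : normedModType R) (f : V) (x s t : R) :
  1 < p -> f != 0 -> completely_smooth p D V ->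
  0 < x -> x < s -> 0 < t ->
  t * (s - x) `^ p + s * (x + t) `^ p <=
  (s + t) * x `^ p + D `^ p * (t * s `^ p + s * t `^ p).
Proof.
move=> p1 f0 [D0 sm] x0 xs t0; have s0 := lt_trans x0 xs.
have st0 : 0 < s + t by lra.
have e01 : 0 <= t / (s + t) <= 1.
  by rewrite divr_ge0 ?ler_pdivrMr ?mul1r//; lra.
pose X (b : bool) : R := if b then - s else t.
have mX : measurable_fun setT X by [].
pose X' : {mfun bool >-> R} := mfun_Sub (mem_set mX).
have iX : (bernoulli_prob (t / (s + t))).-integrable setT (EFin \o X).
  apply/integrableP; split => //.
  by rewrite integral_bernoulli_prob//= -!EFinM -EFinD ltry.
have := sm _ _ (bernoulli_prob (t / (s + t))) X' iX.
rewrite unlock bernoulli_centered// => /(_ erefl (x *: f) f).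
rewrite !integral_bernoulli_prob//.
rewrite /= /X -!scalerDl !normrZ !powRM// !(=^~ EFinM, =^~ EFinD) lee_fin.
have fp0 : 0 < `|f| `^ p by rewrite powR_gt0// normr_gt0.
have -> : `|x - s| = s - x by rewrite ltr0_norm; lra.
rewrite (gtr0_norm x0) (@gtr0_norm _ (x + t)) ?addr_gt0//.
rewrite normrN (gtr0_norm s0) (gtr0_norm t0).
have c0 : 0 < `|f| `^ p / (s + t) by rewrite divr_gt0.
move=> two; rewrite -(ler_pM2r c0); apply: le_trans (le_trans _ two) _.
all: rewrite le_eqVlt; apply/orP; left; apply/eqP; rewrite /unstable.onem; field.
all: by rewrite gt_eqF.
Qed.

(** In the two-point inequality bound [(x + t) `^ p] below by its tangent at
    [x], divide by [t] and let [t] tend to [0]: the quotient defining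
    [Ctilde p] appears on the left and [D `^ p] on the right. *)
Lemma completely_smooth_lower (R : realType) (p D : R) (V : normedModType R)
    (f : V) : 1 < p -> p <= 2 -> f != 0 -> completely_smooth p D V ->
  Ctilde p `^ p^-1 <= D.
Proof.
move=> p1 p2 f0 smD; have [D0 _] := smD; have q0 : 0 < p - 1 by lra.
have Dp0 : 0 < D `^ p by rewrite powR_gt0.
have C1 := Ctilde_ge1 p1 p2.
suff CD : Ctilde p <= D `^ p.
  have -> : D = (D `^ p) `^ p^-1.
    by rewrite -powRrM mulfV ?powRr1 ?ltW// gt_eqF//; lra.
  by rewrite ge0_ler_powR ?nnegrE ?powR_ge0 ?invr_ge0//; lra.
apply: Ctilde_lubP => // x s x0 xs; have s0 := lt_trans x0 xs.
apply/ler_addgt0Pr => e e0.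
(* Chosen so that the remainder [D `^ p * (s * t `^ (p - 1))] equals [e]. *)
pose t := (e / (D `^ p * s)) `^ (p - 1)^-1.
have Ds0 : 0 < D `^ p * s by rewrite mulr_gt0.
have t0 : 0 < t by rewrite powR_gt0 ?divr_gt0.
have tE : D `^ p * (s * t `^ (p - 1)) = e.
  rewrite /t -powRrM mulVf ?gt_eqF// powRr1; last by rewrite divr_ge0// ltW.
  by field; rewrite !gt_eqF.
have two := completely_smooth_two_point p1 f0 smD x0 xs t0.
have tan : s * (x `^ p + t * (p * x `^ (p - 1))) <= s * (x + t) `^ p.
  by rewrite ler_pM2l// powR_tangent_ge//; lra.
have tpE : t `^ p = t * t `^ (p - 1) by rewrite mulr_powRB1// ?ltW//; lra.
by rewrite -tE -(ler_pM2l t0); rewrite tpE in two; lra.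
Qed.

(** * Smoothness, optimality and the martingale bound *)

Theorem corollary1p13 (R : realType) (p : R) (p_gt1 : 1 < p) (p_le2 : p <= 2)
    (d : measure_display) (T : measurableType d)
    (mu : {measure set T -> \bar R}) :
  [/\ completely_smooth p (Ctilde p `^ p^-1) (LspaceType mu (lt1_lee1 p_gt1)),
      (exists f : LspaceType mu (lt1_lee1 p_gt1), f != 0) ->
      forall D : R, completely_smooth p D (LspaceType mu (lt1_lee1 p_gt1)) ->
        Ctilde p `^ p^-1 <= D &
      forall (d' : measure_display) (Omega : measurableType d')
        (P : probability Omega R) (n : nat)
        (S : nat -> Omega -> LspaceType mu (lt1_lee1 p_gt1)),
        (2 <= n)%N -> v_martingale P n S ->
        ('E_P[fun w => (`|S n w| `^ p)%R] <=
         'E_P[fun w => (`|mdiff S 1 w| `^ p)%R] +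
           (Ctilde p)%:E *
           \sum_(2 <= j < n.+1) 'E_P[fun w => (`|mdiff S j w| `^ p)%R])%E].
Proof.
have C0 : 0 <= Ctilde p by have := Ctilde_ge1 p_gt1 p_le2; lra.
split; first exact: Lspace_completely_smooth.
  by move=> [f f0] D; exact: completely_smooth_lower f0.
move=> d' Omega P n S n2 mS.
apply: v_martingale_smooth mS _ => //; last exact: ltnW.
exact: Lspace_almost_tangent.
Qed.
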